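(* Let $d\in\mathbb{N}$, let $S\subseteq\mathbb{R}^d$ be any subset, and let $\xi_1,\xi_2,\dots$ be i.i.d. Rademacher random variables. Suppose that there exists $m\ge1$ such that either (a) $\Pr(a_1\xi_1+\dots+a_{m+1}\xi_{m+1}\in S)<1/2$ for all nonzero $a_1,\dots,a_{m+1}\in\mathbb{R}^d$, or (b) $\Pr(a_1\xi_1+\dots+a_m\xi_m\in S')<1$ for all nonzero $a_1,\dots,a_m\in\mathbb{R}^d$ and all translates $S'$ of $S$. Then for all $n$ and all nonzero vectors $a_1,\dots,a_n\in\mathbb{R}^d$, we have $\Pr(X\in S)\le C_m\rho^{1/(m2^{m-1})}$, where $X=a_1\xi_1+\dots+a_n\xi_n$, $\rho=\max_{x\in\mathbb{R}^d}\Pr(X=x)$, and $C_m$ is a constant depending only on $m$.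
   Context: A Rademacher random variable takes the values $1$ and $-1$ each with probability $1/2$. A translate of $S$ is a set $S-b=\{s-b:s\in S\}$ for some $b\in\mathbb{R}^d$. *)

(* Defs.v *)
From HB Require Import structures.
From mathcomp Require Import all_boot all_order all_algebra finmap.
From mathcomp Require Import all_classical all_reals all_analysis.

Set Implicit Arguments.
Unset Strict Implicit.
Unset Printing Implicit Defensive.

Import Order.TTheory GRing.Theory Num.Theory.
Import numFieldNormedType.Exports.

Local Open Scope classical_set_scope.
Local Open Scope ring_scope.

Definition mutually_independent d d' (T : measurableType d)
    (T' : measurableType d') (R : realType) (P : probability T R)
    (I : choiceType) (X : I -> {RV P >-> T'}) : Prop :=
  forall (J : {fset I}) (B : I -> set T'),
    (forall i, i \in J -> measurable (B i)) ->
    P (\bigcap_(i in [set` J]) (X i @^-1` B i)) =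
    (\prod_(i <- J) P (X i @^-1` B i))%E.

Definition rademacher d (T : measurableType d) (R : realType)
    (P : probability T R) (X : {dRV P >-> R}) : Prop :=
  P (X @^-1` [set 1]) = (2^-1)%:E /\ P (X @^-1` [set - 1]) = (2^-1)%:E.

(* Discreteness (countable range) of the variables makes every event
   [sum_i a_i xi_i \in S] measurable, for arbitrary S, even if the xi_i take
   values other than 1 and -1 on a null set. *)
Definition iid_rademacher d (T : measurableType d) (R : realType)
    (P : probability T R) (xi : nat -> {dRV P >-> R}) : Prop :=
  (forall i, rademacher (xi i)) /\
  mutually_independent (fun i => xi i : {RV P >-> R}).

(* The indices start at 0: a_1, ..., a_n in the usual notation are
   a 0, ..., a (n - 1), paired with xi 0, ..., xi (n - 1). *)
Definition rsum d (T : measurableType d) (R : realType) (P : probability T R)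
    (xi : nat -> {dRV P >-> R}) (k n : nat) (a : 'I_n -> 'rV[R]_k) :
    T -> 'rV[R]_k :=
  fun t => \sum_(i < n) xi i t *: a i.

Definition translate (R : realType) (k : nat) (S : set 'rV[R]_k)
    (b : 'rV[R]_k) : set 'rV[R]_k := [set s - b | s in S].

(* For an rsum of Rademacher variables this supremum is a maximum: the
   rsum is almost surely supported on a finite set. *)
Definition max_point_prob d (T : measurableType d) (R : realType)
    (P : probability T R) (U : Type) (X : T -> U) : \bar R :=
  ereal_sup [set P (X @^-1` [set x]) | x in [set: U]].

(* Main.v *)
(** Both hypotheses imply that [S] contains no translate of a cube
[{+-a_1 +- ... +- a_m}] with nonzero sides: for a translate by [b != 0], add
[b] to the sides to contradict (a); for a centred cube, replace one side by
two copies of its half.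

Split [X = X_1 + ... + X_m] into blocks.  By Cauchy-Schwarz, with [X_1'] an
independent copy of [X_1],
  [P(X \in S)^2 <= P(X_1 = X_1') + P(X_1 != X_1', X_2 + ... + X_m \in S')]
where [S' = (S - X_1) `&` (S - X_1')] contains no [(m-1)]-cube as soon as
[X_1 != X_1'].  Iterating, if every block has point probabilities at most
[e^(2^(m-1))], then [P(X \in S) <= 2 e].  Appending one vector at most halves
the maximal point probability, and the product of the maxima of the blocks is
at most [rho], so a greedy choice of blocks achieves
[e^(m 2^(m-1)) = 2^(m-1) rho]. *)
Require Import Defs.
From HB Require Import structures.
From mathcomp Require Import all_boot all_order all_algebra finmap.
From mathcomp Require Import all_classical all_reals all_analysis.
From mathcomp Require Import ring lra.

Set Implicit Arguments.
Unset Strict Implicit.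
Unset Printing Implicit Defensive.

Import Order.TTheory GRing.Theory Num.Theory.
Import numFieldNormedType.Exports.

Local Open Scope classical_set_scope.
Local Open Scope ring_scope.

(** * Averages over independent signs *)

Section SignedSums.
Variables (R : realType) (V : lmodType R).
Implicit Types (L : seq V) (f g : V -> R) (S : set V).

(* The expectation of [f (sum_i xi_i a_i)] for [L = [:: a_1; ...; a_n]] and
   independent Rademacher signs [xi_i]. *)
Fixpoint sign_mean L f : R :=
  if L is a :: L' then
    (sign_mean L' (fun x => f (a + x)) + sign_mean L' (fun x => f (- a + x))) / 2
  else f 0.

Lemma eq_sign_mean L f g : f =1 g -> sign_mean L f = sign_mean L g.
Proof. by move=> /funext ->. Qed.

Lemma ler_sign_mean L f g :
  (forall x, f x <= g x) -> sign_mean L f <= sign_mean L g.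
Proof.
elim: L f g => [|a L IH] f g fg //=.
by rewrite ler_pM2r ?invr_gt0 ?ltr0n// lerD ?IH.
Qed.

Lemma sign_mean_cst L (c : R) : sign_mean L (fun=> c) = c.
Proof. by elim: L => //= a L ->; field. Qed.

Lemma sign_meanD L f g :
  sign_mean L (fun x => f x + g x) = sign_mean L f + sign_mean L g.
Proof. by elim: L f g => //= a L IH f g; rewrite !IH; field. Qed.

Lemma sign_meanZ L (c : R) f :
  sign_mean L (fun x => c * f x) = c * sign_mean L f.
Proof. by elim: L f => //= a L IH f; rewrite !IH; field. Qed.

Lemma sign_mean_ge0 L f : (forall x, 0 <= f x) -> 0 <= sign_mean L f.
Proof. by move=> f0; rewrite -(sign_mean_cst L 0) ler_sign_mean. Qed.

Lemma sign_mean_cat L1 L2 f :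
  sign_mean (L1 ++ L2) f =
  sign_mean L1 (fun x => sign_mean L2 (fun y => f (x + y))).
Proof.
elim: L1 f => [|a L1 IH] f /=.
  by apply: eq_sign_mean => y; rewrite add0r.
rewrite !IH.
by congr ((_ + _) / _); apply: eq_sign_mean => x; apply: eq_sign_mean => y;
  rewrite addrA.
Qed.

Lemma exchange_sign_mean L1 L2 (f : V -> V -> R) :
  sign_mean L1 (fun x => sign_mean L2 (f x)) =
  sign_mean L2 (fun y => sign_mean L1 (f^~ y)).
Proof.
elim: L1 f => //= a L1 IH f; rewrite !IH.
under [RHS]eq_sign_mean do rewrite mulrC.
by rewrite sign_meanZ sign_meanD mulrC.
Qed.

(** Cauchy-Schwarz, by induction: averaging over one sign loses the square of half the difference of
    the two conditional means. *)
Lemma sqr_sign_mean_le L f :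
  (sign_mean L f) ^+ 2 <= sign_mean L (fun x => f x ^+ 2).
Proof.
elim: L f => //= a L IH f.
have := IH (fun x => f (a + x)); have := IH (fun x => f (- a + x)).
set u := sign_mean L _; set v := sign_mean L _.
set p := sign_mean L _; set q := sign_mean L _.
by move=> h1 h2; have := sqr_ge0 (p - u); nra.
Qed.

Lemma indic_le1 S x : \1_S x <= 1 :> R.
Proof. by rewrite indicE; case: (_ \in _). Qed.

Lemma indic_ge0 S x : 0 <= \1_S x :> R.
Proof. by rewrite indicE ler0n. Qed.

Lemma indic_eq (A : Type) (B : Type) (S : set A) (S' : set B) x y :
  (S x <-> S' y) -> \1_S x = \1_S' y :> R.
Proof.
move=> h; rewrite !indicE; congr (nat_of_bool _)%:R.
by apply/idP/idP; rewrite !inE => /h.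
Qed.

(** * Point probabilities and the greedy splitting into blocks *)

Lemma exists_point_mean_gt0 L : exists x, 0 < sign_mean L \1_[set x].
Proof.
elim: L => [|a L [x x0]] /=; first by exists 0; rewrite indicE mem_set.
exists (a + x); rewrite divr_gt0// ltr_wpDr//.
  by apply: sign_mean_ge0 => y; exact: indic_ge0.
rewrite (_ : sign_mean _ _ = sign_mean L \1_[set x])//.
by apply: eq_sign_mean => y; apply: indic_eq; split=> [/addrI//|/= ->].
Qed.

Definition conc_le L (r : R) := forall x, sign_mean L \1_[set x] <= r.

(** The two partial sums are independent, and hitting [x] and [y] forces the total to hit
    [x + y]. *)
Lemma point_mean_cat L1 L2 (x y : V) :
  sign_mean L1 \1_[set x] * sign_mean L2 \1_[set y]
  <= sign_mean (L1 ++ L2) \1_[set x + y].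
Proof.
rewrite sign_mean_cat mulrC -sign_meanZ; apply: ler_sign_mean => u.
rewrite mulrC -sign_meanZ; apply: ler_sign_mean => v.
rewrite !indicE; case: (boolP (u \in _)) => [|_]; last by rewrite mul0r ler0n.
rewrite inE => /= ->; case: (boolP (v \in _)) => [|_]; last by rewrite mulr0 ler0n.
by rewrite inE => /= ->; rewrite mem_set // mulr1.
Qed.

(* A shortest prefix with point probabilities at most [r] still has a point
   probability larger than [r / 2]. *)
Lemma exists_prefix L (r : R) : r < 1 -> conc_le L r ->
  exists L1 L2 x, [/\ L = L1 ++ L2, conc_le L1 r & r / 2 <= sign_mean L1 \1_[set x]].
Proof.
move=> r1 cL.
have hex : exists n, `[<conc_le (take n L) r>].
  by exists (size L); apply/asboolP; rewrite take_size.
case: (ex_minnP hex) => -[|n] /asboolP cn minn.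
  (* The empty prefix has an atom of mass [1 > r], so the shortest good prefix is nonempty. *)
  by have := cn 0; rewrite take0 /= indicE mem_set //= leNgt r1.
have nL : (n < size L)%N.
  rewrite ltnNge; apply/negP => Ln.
  suff /minn : `[<conc_le (take n L) r>] by rewrite ltnn.
  by apply/asboolP; rewrite take_oversize.
have /asboolPn/existsNP[x /negP] : ~~ `[<conc_le (take n L) r>].
  by apply/negP => /minn; rewrite ltnn.
rewrite -ltNge => xr.
(* By minimality the prefix of length [n] has an atom [x] of mass above [r]; the sign [+1] on the
   next vector retains half of it. *)
exists (take n.+1 L), (drop n.+1 L), (x + nth 0 L n); split=> //.
  by rewrite cat_take_drop.
rewrite (take_nth 0 nL) -cats1.
apply: (le_trans _ (point_mean_cat _ _ _ _)) => /=.
have -> : \1_[set nth 0 L n] (nth 0 L n + 0) = 1 :> R.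
  by rewrite addr0 indicE mem_set.
have := sign_mean_ge0 (take n L) (indic_ge0 [set x]).
have := indic_ge0 [set nth 0 L n] (- nth 0 L n + 0).
by move: xr; set p := sign_mean _ _; set q := \1_ _ _; nra.
Qed.

(** Each block cut off has an atom of mass at least [r / 2], so the bound for the remaining vectors
    is divided by [r / 2]; this explains the form of the hypothesis. *)
Lemma exists_balanced_split k L (r : R) : 0 < r -> conc_le L (r ^+ k.+1 / 2 ^+ k) ->
  exists Ls : seq (seq V), [/\ size Ls = k.+1, flatten Ls = L &
    forall L', L' \in Ls -> conc_le L' r].
Proof.
move=> r0; elim: k L => [|k IH] L cL.
  exists [:: L]; split=> //=; first by rewrite cats0.
  by move=> L'; rewrite inE => /eqP -> x; have := cL x; rewrite expr1 expr0 divr1.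
have [r1|r1] := leP 1 r.
  (* For [1 <= r] every list qualifies, so empty blocks serve as padding. *)
  exists (L :: nseq k.+1 [::]); split => /=.
  - by rewrite size_nseq.
  - by rewrite (_ : flatten _ = [::]) ?cats0//; elim: k {IH cL} => //=.
  - move=> L' _ x; apply: le_trans r1.
    by rewrite -(sign_mean_cst L' 1) ler_sign_mean // => y; exact: indic_le1.
have rk (j : nat) : r ^+ j.+1 / 2 ^+ j <= r.
  rewrite exprS -mulrA ler_piMr ?(ltW r0)//.
  by rewrite -expr_div_n exprn_ile1 ?divr_ge0 ?(ltW r0)//; lra.
have cLr : conc_le L r by move=> x; apply: le_trans (cL x) (rk k.+1).
have [L1 [L2 [x [LE cL1 xL1]]]] := exists_prefix r1 cLr.
have {}/IH : conc_le L2 (r ^+ k.+1 / 2 ^+ k).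
  move=> y; have := cL (x + y); rewrite LE => /(le_trans (point_mean_cat _ _ _ _)).
  have := sign_mean_ge0 L2 (indic_ge0 [set y]).
  move: xL1; set p := sign_mean _ _; set q := sign_mean _ _ => hp q0 hpq.
  have {hp}hp : r / 2 * q <= r / 2 * (r ^+ k.+1 / 2 ^+ k).
    apply: le_trans (ler_wpM2r q0 hp) _; apply: le_trans hpq _.
    by rewrite !exprS invfM le_eqVlt; apply/orP; left; apply/eqP; ring.
  by rewrite ler_pM2l ?divr_gt0 in hp.
move=> [Ls [sLs fLs cLs]]; exists (L1 :: Ls); split=> /=.
- by rewrite sLs.
- by rewrite fLs.
- by move=> L'; rewrite inE => /predU1P[->|/cLs].
Qed.

(** * Cube-free sets and the decoupling induction *)

(* [S] contains no translate of a possibly degenerate cube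
   [{+-a_1 +- ... +- a_m}] with nonzero sides. *)
Definition cube_free m S := forall L (b : V), size L = m -> 0 \notin L ->
  sign_mean L (fun x => \1_S (b + x)) < 1.

Lemma half_double (x : V) : 2^-1 *: (x + x) = x.
Proof. by rewrite scalerDr -scalerDl -[RHS]scale1r; congr (_ *: _); lra. Qed.

Lemma half_addD_sub (x y : V) : 2^-1 *: (x + y) + 2^-1 *: (x - y) = x.
Proof. by rewrite -scalerDr addrACA subrr addr0 half_double. Qed.

Lemma half_addB_sub (x y : V) : 2^-1 *: (x + y) - 2^-1 *: (x - y) = y.
Proof. by rewrite -scalerBr opprB addrC addrA subrK half_double. Qed.

Lemma cube_free1 S x y : cube_free 1 S -> S x -> S y -> x = y.
Proof.
move=> cS Sx Sy; apply: contrapT => /eqP xy.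
have := cS [:: 2^-1 *: (x - y)] (2^-1 *: (x + y)) erefl.
rewrite inE eq_sym scaler_eq0 invr_eq0 pnatr_eq0 subr_eq0 (negbTE xy) => /(_ isT) /=.
rewrite !addr0 half_addD_sub half_addB_sub.
by rewrite !indicE !mem_set//= -[X in X < _]/((1 + 1) / 2); lra.
Qed.

(** If the intersection contained a cube [Q], then [x + Q] and [y + Q] would be opposite facets of a
    cube in [S] with the extra side [(x - y) / 2], its centre shifted by [(x + y) / 2]. *)
Lemma cube_freeS m S x y : cube_free m.+1 S -> x != y ->
  cube_free m [set z | S (x + z) /\ S (y + z)].
Proof.
move=> cS xy L b sL L0; rewrite ltNge; apply/negP => h.
have := cS (2^-1 *: (x - y) :: L) (2^-1 *: (x + y) + b).
rewrite /= sL inE negb_or L0 eq_sym scaler_eq0 invr_eq0 pnatr_eq0 subr_eq0 (negbTE xy).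
move=> /(_ erefl isT).
have hx z : 2^-1 *: (x + y) + b + (2^-1 *: (x - y) + z) = x + (b + z).
  by rewrite addrACA half_addD_sub.
have hy z : 2^-1 *: (x + y) + b + (- (2^-1 *: (x - y)) + z) = y + (b + z).
  by rewrite addrACA half_addB_sub.
under eq_sign_mean do rewrite hx.
under [X in _ + X]eq_sign_mean do rewrite hy.
have := le_trans h (@ler_sign_mean L _ (fun z => \1_S (x + (b + z))) _).
have := le_trans h (@ler_sign_mean L _ (fun z => \1_S (y + (b + z))) _).
set p := sign_mean L _; set q := sign_mean L _ => hp hq.
suff : 1 <= p /\ 1 <= q by lra.
by split; [apply: hp|apply: hq] => z; rewrite !indicE ler_nat;
  case: (boolP (b + z \in _)) => //; rewrite inE => -[h1 h2]; rewrite mem_set.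
Qed.

Lemma cube_free_mean_le m S (Ls : seq (seq V)) (e : R) : 0 <= e <= 1 ->
  cube_free m.+1 S -> size Ls = m.+1 ->
  (forall L, L \in Ls -> conc_le L (e ^+ (2 ^ m))) ->
  sign_mean (flatten Ls) \1_S <= 2 * e.
Proof.
elim: m S Ls e => [|m IH] S [//|L Ls] e /andP[e0 e1] cS /= [sLs] cLs.
  move: Ls sLs cLs => [//|//] _ cLs; rewrite /= cats0.
  (* Two distinct points form a one-dimensional cube, so [S] has at most one point. *)
  have [[x Sx]|S0] := pselect (exists x, S x).
    have -> : S = [set x].
      by apply/seteqP; split=> [y Sy|y ->//] /=; exact: cube_free1 cS Sy Sx.
    have := cLs L (mem_head _ _) x; rewrite expn0 expr1; lra.
  apply: le_trans (_ : 0 <= _); last lra.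
  rewrite -(sign_mean_cst L 0); apply: ler_sign_mean => x.
  by rewrite indicE memNset // => Sx; apply: S0; exists x.
rewrite sign_mean_cat exchange_sign_mean.
set p := sign_mean _ _.
(* The diagonal will contribute at most [e ^+ 2] and the remaining pairs at most [2 * e ^+ 2]; the
   total is below [(2 * e) ^+ 2]. *)
suff : p ^+ 2 <= 3 * e ^+ 2 by move=> h; rewrite leNgt; apply/negP => h'; nra.
apply: le_trans (sqr_sign_mean_le _ _) _.
(* The square becomes an average over two independent copies [x], [x'] of the first block. *)
have eqsq y : sign_mean L (fun x => \1_S (x + y)) ^+ 2 =
    sign_mean L (fun x => sign_mean L (fun x' => \1_S (x + y) * \1_S (x' + y))).
  rewrite expr2 -sign_meanZ; apply: eq_sign_mean => x.
  by rewrite mulrC -sign_meanZ.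
under eq_sign_mean do rewrite eqsq.
rewrite -exchange_sign_mean; under eq_sign_mean do rewrite -exchange_sign_mean.
have e2 : 0 <= e ^+ 2 <= 1 by rewrite sqr_ge0 exprn_ile1.
have pair x x' : sign_mean (flatten Ls) (fun y => \1_S (x + y) * \1_S (x' + y))
    <= \1_[set x] x' + 2 * e ^+ 2.
  rewrite [X in X + _]indicE; have [->|xx'] := eqVneq x' x.
    rewrite mem_set//=; apply: (@le_trans _ _ 1); last by lra.
    rewrite -[leRHS](sign_mean_cst (flatten Ls)); apply: ler_sign_mean => y.
    by rewrite -[leRHS]mulr1 ler_pM ?indic_ge0 ?indic_le1.
  rewrite memNset; last by move=> /= xE; rewrite xE eqxx in xx'.
  rewrite add0r.
  have -> : (fun y => \1_S (x + y) * \1_S (x' + y)) =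
      \1_[set z | S (x + z) /\ S (x' + z)] :> (V -> R).
    apply/funext => y; rewrite !indicE -natrM mulnb; congr (nat_of_bool _)%:R.
    by apply/andP/idP; rewrite !inE.
  (* The induction hypothesis is applied with [e ^+ 2] for [e], which matches the doubled exponent
     in the block bound. *)
  apply: IH => //; first by apply: cube_freeS => //; rewrite eq_sym.
  move=> L' L'Ls; rewrite -exprM -expnS; apply: cLs.
  by rewrite inE L'Ls orbT.
apply: (@le_trans _ _ (e ^+ (2 ^ m.+1) + 2 * e ^+ 2)).
  rewrite -[leRHS](sign_mean_cst L); apply: ler_sign_mean => x.
  apply: le_trans (ler_sign_mean _ (pair x)) _.
  by rewrite sign_meanD sign_mean_cst lerD2r cLs ?mem_head.
have : e ^+ (2 ^ m.+1) <= e ^+ 2.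
  by apply: ler_wiXn2l => //; rewrite expnS leq_pmulr ?expn_gt0.
lra.
Qed.

Lemma cube_free_of_half m S :
  (forall L, size L = m.+2 -> 0 \notin L -> sign_mean L \1_S < 2^-1) ->
  cube_free m.+1 S.
Proof.
move=> hS L b sL L0; rewrite ltNge; apply/negP => h.
have [b0|b0] := eqVneq b 0.
  move: L sL L0 h => [//|c L] [sL]; rewrite inE negb_or eq_sym => /andP[c0 L0].
  rewrite b0; under eq_sign_mean do rewrite add0r.
  move=> /= h.
  (* Two halves of [c] with equal signs, an event of probability one half, reproduce the side [c];
     the mixed signs only need to contribute a nonnegative amount. *)
  have := hS (2^-1 *: c :: 2^-1 *: c :: L).
  rewrite /= sL !inE !negb_or L0 eq_sym scaler_eq0 invr_eq0 pnatr_eq0 (negbTE c0).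
  move=> /(_ erefl isT).
  have hp x : 2^-1 *: c + (2^-1 *: c + x) = c + x by rewrite addrA -scalerDr half_double.
  have hn x : - (2^-1 *: c) + (- (2^-1 *: c) + x) = - c + x.
    by rewrite addrA -opprD -scalerDr half_double.
  under eq_sign_mean do rewrite hp.
  under [X in _ + (_ + X) / 2]eq_sign_mean do rewrite hn.
  move: h; set p := sign_mean L _; set q := sign_mean L _.
  set u := sign_mean L _; set v := sign_mean L _.
  have : 0 <= u by apply: sign_mean_ge0 => x; exact: indic_ge0.
  have : 0 <= v by apply: sign_mean_ge0 => x; exact: indic_ge0.
  lra.
(* With [b] as an extra side, its sign [+1] alone already gives probability at least one half. *)
have := hS (b :: L); rewrite /= sL inE negb_or L0 eq_sym b0 => /(_ erefl isT).
have : 0 <= sign_mean L (fun x => \1_S (- b + x)).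
  by apply: sign_mean_ge0 => x; exact: indic_ge0.
move: h; lra.
Qed.

End SignedSums.

(** * The law of a Rademacher sum as an average over signs *)

Section RademacherSums.
Context (R : realType) (disp : measure_display) (T : measurableType disp).
Context (P : probability T R) (xi : nat -> {dRV P >-> R}).

(** The offset [k] lets induction on [L] pass to the next variable. *)
Definition tail_sum (V : lmodType R) k (L : seq V) (t : T) : V :=
  \sum_(i < size L) xi (k + i) t *: nth 0 L i.

Lemma tail_sum_cons (V : lmodType R) k (a : V) L t :
  tail_sum k (a :: L) t = xi k t *: a + tail_sum k.+1 L t.
Proof.
rewrite /tail_sum /= big_ord_recl /= addn0; congr (_ + _).
by apply: eq_bigr => i _; rewrite /bump /= add1n addnS addSn.
Qed.

Lemma measurable_preimage1 i (v : R) : measurable (xi i @^-1` [set v]).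
Proof. by rewrite -[X in measurable X]setTI; exact/measurable_funP. Qed.

Lemma preimage_tail_sum_cons (V : lmodType R) k (a : V) L (S : set V) (v : R) :
  tail_sum k (a :: L) @^-1` S `&` xi k @^-1` [set v] =
  tail_sum k.+1 L @^-1` [set x | S (v *: a + x)] `&` xi k @^-1` [set v].
Proof.
by apply/seteqP; split => t /= [+ tv]; rewrite tail_sum_cons tv.
Qed.

(** For arbitrary [S], the event is a countable union over the values of [xi k], on each of which
    [S] is merely translated. *)
Lemma measurable_tail_sum (V : lmodType R) k (L : seq V) (S : set V) :
  measurable (tail_sum k L @^-1` S).
Proof.
elim: L k S => [|a L IH] k S.
  have [S0|S0] := pselect (S 0).
    rewrite (_ : _ @^-1` _ = setT) //; apply/seteqP; split=> // t _.
    by rewrite /= /tail_sum big_ord0.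
  rewrite (_ : _ @^-1` _ = set0) //; apply/seteqP; split=> // t.
  by rewrite /= /tail_sum big_ord0.
rewrite (_ : _ @^-1` S = \bigcup_(j in dRV_dom (xi k))
    (tail_sum k (a :: L) @^-1` S `&`
     xi k @^-1` [set dRV_enum (xi k) j])); last first.
  apply/seteqP; split => [t St|t [j _ []]//].
  have [j jk jE] := @surj _ _ _ _ (dRV_enum (xi k)) (xi k t) (imageT _ _).
  by exists j.
apply: bigcup_measurable => j _.
rewrite preimage_tail_sum_cons; apply: measurableI; first exact: IH.
exact: measurable_preimage1.
Qed.

Hypothesis hxi : iid_rademacher xi.

Definition prefix_event k (e : nat -> R) : set T :=
  [set t | forall i, (i < k)%N -> xi i t = e i].

Lemma prefix_event_bigcap k e : prefix_event k e =
  \bigcap_(i in [set` [fset i in iota 0 k]%fset]) xi i @^-1` [set e i].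
Proof.
apply/seteqP; split=> t /= h i.
  by move=> /=; rewrite !inE mem_iota add0n => /h.
by move=> ik; apply: (h i); rewrite /= !inE mem_iota.
Qed.

Lemma measurable_prefix_event k e : measurable (prefix_event k e).
Proof.
rewrite prefix_event_bigcap; exact: fin_bigcap_measurable.
Qed.

Definition is_sign (v : R) := v = 1 \/ v = - 1.

Lemma prob_sign i v : is_sign v -> P (xi i @^-1` [set v]) = (2^-1)%:E.
Proof. by case=> ->; [exact: (hxi.1 i).1|exact: (hxi.1 i).2]. Qed.

Lemma prefix_event_prob k e : (forall i, is_sign (e i)) ->
  P (prefix_event k e) = (2^-1 ^+ k)%:E.
Proof.
move=> he; rewrite prefix_event_bigcap.
rewrite (hxi.2 _ (fun i => [set e i]))//.
under eq_bigr do rewrite prob_sign//.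
rewrite prodEFin big_const_seq count_predT iter_mulr_1; congr ((_ ^+ _)%:E).
by rewrite -[RHS](size_iota 0) card_fseq undup_id ?iota_uniq.
Qed.

Lemma prob_not_sign i : P (~` (xi i @^-1` [set 1] `|` xi i @^-1` [set - 1])) = 0%E.
Proof.
have m1 := measurable_preimage1 i 1; have mN1 := measurable_preimage1 i (-1).
rewrite probability_setC; last exact: measurableU.
have -> : P (xi i @^-1` [set 1] `|` xi i @^-1` [set - 1]) =
    (P (xi i @^-1` [set 1%R]) + P (xi i @^-1` [set (- 1)%R]))%E.
  rewrite measureU//; apply/seteqP; split=> t //= [-> h]; lra.
have -> := prob_sign i (or_introl erefl : is_sign 1).
have -> := prob_sign i (or_intror erefl : is_sign (- 1)).
by rewrite -!EFinD; congr (_%:E); lra.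
Qed.

(** Fixing the first [k] signs makes the induction work: each step moves one sign from the tail into
    the prefix, so independence is needed only for prefix events. *)
Lemma prob_prefix_tail (V : lmodType R) (L : seq V) k e (S : set V) :
  (forall i, is_sign (e i)) ->
  P (prefix_event k e `&` tail_sum k L @^-1` S) =
  (2^-1 ^+ k * sign_mean L \1_S)%:E.
Proof.
elim: L k e S => [|a L IH] k e S he /=.
  have [S0|S0] := pselect (S 0).
    rewrite indicE mem_set// mulr1 -(prefix_event_prob k he); congr (P _).
    by apply/seteqP; split=> [t []//|t ht]; split=> //=; rewrite /tail_sum big_ord0.
  rewrite indicE memNset// mulr0 (_ : _ `&` _ = set0) ?measure0//.
  by apply/seteqP; split=> [t []//=|//]; rewrite /tail_sum big_ord0.
set A := _ `&` _.
have mA : measurable A.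
  apply: measurableI; [exact: measurable_prefix_event|exact: measurable_tail_sum].
have m1 := measurable_preimage1 k 1; have mN1 := measurable_preimage1 k (-1).
have part v : is_sign v -> P (A `&` xi k @^-1` [set v]) =
    (2^-1 ^+ k.+1 * sign_mean L (fun x => \1_S (v *: a + x)))%:E.
  move=> hv; pose e' i := if i == k then v else e i.
  have he' i : is_sign (e' i) by rewrite /e'; case: ifP.
  rewrite /A -setIA preimage_tail_sum_cons setICA setIC -setIA.
  transitivity (P (prefix_event k.+1 e' `&`
      tail_sum k.+1 L @^-1` [set x | S (v *: a + x)])).
    congr (P _); apply/seteqP; split=> t /=.
    - move=> [hk [hS hv']]; split=> // i; rewrite ltnS leq_eqVlt /e'.
      by case: eqVneq => [->|_] //= /hk.
    - move=> [hk hS]; split; last split=> //.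
      + move=> i ik; rewrite (hk i (leqW ik)) /e' ifF//.
        by apply/negbTE; rewrite neq_ltn ik.
      + by rewrite hk// /e' eqxx.
  by rewrite IH.
(* The two signs exhaust the values of [xi k] up to a null set. *)
have -> : P A = (P (A `&` xi k @^-1` [set 1%R]) +
                 P (A `&` xi k @^-1` [set (- 1)%R]))%E.
  rewrite (measureDI P mA (measurableU _ _ m1 mN1)) [X in (X + _)%E](_ : _ = 0%E).
    rewrite add0e setIUr measureU//; try exact: measurableI.
    apply/seteqP; split=> t //= [[_ h1] [_ h2]]; move: h1; rewrite h2; lra.
  rewrite setDE; apply: (subset_measure0 _ _ _ (prob_not_sign k)) => //.
  - by apply: measurableI => //; apply: measurableC; exact: measurableU.
  - by apply: measurableC; exact: measurableU.
rewrite !part; [|by right|by left].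
rewrite -EFinD; congr (_%:E).
under eq_sign_mean do rewrite scale1r.
under [X in _ + _ * X]eq_sign_mean do rewrite scaleN1r.
by rewrite exprSr; field.
Qed.

Lemma prob_rsum d n (a : 'I_n -> 'rV[R]_d) (S : set 'rV[R]_d) :
  P (rsum xi a @^-1` S) = (sign_mean (codom a) \1_S)%:E.
Proof.
have -> : rsum xi a = tail_sum 0 (codom a).
  apply/funext => t; rewrite /rsum /tail_sum size_codom card_ord.
  apply: eq_bigr => i _.
  by rewrite add0n codomE (nth_map i) ?nth_ord_enum ?size_enum_ord.
(* The prefix is empty, so the sign pattern is arbitrary. *)
have := @prob_prefix_tail _ (codom a) 0 (fun=> 1) S.
rewrite expr0 mul1r => <-; last by left.
by rewrite (_ : prefix_event _ _ = setT) ?setTI//; apply/seteqP; split.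
Qed.

End RademacherSums.

(** * The concentration bound and its constant *)

Theorem theorem1p4 (R : realType) (m : nat) (hm : (1 <= m)%N) :
  exists C : R,
  forall (disp : measure_display) (T : measurableType disp)
    (P : probability T R) (xi : nat -> {dRV P >-> R})
    (hxi : iid_rademacher xi) (d : nat) (S : set 'rV[R]_d),
  ((forall a : 'I_m.+1 -> 'rV[R]_d, (forall i, a i != 0) ->
      (P (rsum xi a @^-1` S) < (2^-1)%:E)%E)
   \/
   (forall (a : 'I_m -> 'rV[R]_d) (b : 'rV[R]_d), (forall i, a i != 0) ->
      (P (rsum xi a @^-1` translate S b) < 1)%E)) ->
  forall (n : nat) (a : 'I_n -> 'rV[R]_d), (forall i, a i != 0) ->
    (P (rsum xi a @^-1` S) <=
      C%:E * max_point_prob P (rsum xi a) `^ (m * 2 ^ (m - 1))%:R^-1)%E.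
Proof.
case: m hm => [//|m] _; rewrite subn1 /=.
set N := (m.+1 * 2 ^ m)%N.
have N0 : N%:R != 0 :> R by rewrite pnatr_eq0 muln_eq0 expn_eq0.
(* Here [m] is one less than in the statement. The constant turns the claim into the bound [2 * e]
   with [e ^+ N = 2 ^+ m * r]. *)
exists (2 * (2 ^+ m) `^ N%:R^-1) => disp T P xi hxi d S hS n a _.
have {hS}cS : cube_free m.+1 S.
  have codomL k (L : seq 'rV[R]_d) : size L = k -> 0 \notin L ->
      exists2 a' : 'I_k -> 'rV[R]_d, codom a' = L & forall i, a' i != 0.
    move=> <- L0; exists (tnth (in_tuple L)) => [|i].
      by rewrite codomE map_tnth_enum.
    by apply: contraNneq L0 => <-; exact: mem_tnth.
  case: hS => hS.
    apply: cube_free_of_half => L /codomL + /[dup] L0 => /(_ L0)[a' <- a'0].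
    by have := hS a' a'0; rewrite prob_rsum.
  move=> L b /codomL + /[dup] L0 => /(_ L0)[a' <- a'0].
  have := hS a' b a'0; rewrite prob_rsum// lte_fin.
  have -> : sign_mean (codom a') \1_(translate S b) =
      sign_mean (codom a') (fun x => \1_S (b + x)); last by [].
  apply: eq_sign_mean => x; apply: indic_eq.
  split=> [[s Ss <-]|Sx]; first by rewrite addrC subrK.
  by exists (b + x) => //; rewrite addrAC subrr add0r.
set rho := max_point_prob _ _.
have point_le_rho x : (P (rsum xi a @^-1` [set x]) <= rho)%E.
  by apply: ereal_sup_ubound; exists x.
have rho_le1 : (rho <= 1)%E.
  apply: ub_ereal_sup => _ [x _ <-]; rewrite prob_rsum// lee_fin.
  by rewrite -(sign_mean_cst (codom a) 1) ler_sign_mean// => y; exact: indic_le1.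
have rho_ge0 : (0 <= rho)%E by apply: le_trans (point_le_rho 0).
have rho_fin : rho \is a fin_num.
  by rewrite ge0_fin_numE // (le_lt_trans rho_le1) ?ltry.
rewrite -(fineK rho_fin) in rho_ge0 point_le_rho *.
move: (fine rho) rho_ge0 point_le_rho => r; rewrite lee_fin => r0 hr.
rewrite poweR_EFin -EFinM prob_rsum// lee_fin -mulrA -powRM ?exprn_ge0//.
set e := _ `^ _.
have e0 : 0 <= e by exact: powR_ge0.
have eN : e ^+ N = 2 ^+ m * r.
  by rewrite -powR_mulrn// -powRrM mulVf// powRr1// mulr_ge0 ?exprn_ge0.
have conca : conc_le (codom a) r.
  by move=> x; rewrite -lee_fin -(prob_rsum hxi).
(* For [1 < e] the bound exceeds one and is trivial. *)
have [e1|e1] := ltP 1 e.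
  apply: (@le_trans _ _ 1); last by lra.
  by rewrite -(sign_mean_cst (codom a) 1) ler_sign_mean// => y; exact: indic_le1.
have rpos : 0 < r.
  by have [x /lt_le_trans] := exists_point_mean_gt0 (codom a); apply.
have epos : 0 < e.
  rewrite lt_neqAle e0 andbT; apply/eqP => e0'; move: eN.
  rewrite -e0' expr0n muln_eq0 expn_eq0 /= => /esym/eqP.
  by rewrite mulf_eq0 expf_eq0 pnatr_eq0 andbF gt_eqF.
(* By the choice of [e] this bound equals [r], so the list splits into [m.+1] blocks with atoms of
   mass at most [e ^+ (2 ^ m)]. *)
have concb : conc_le (codom a) ((e ^+ (2 ^ m)) ^+ m.+1 / 2 ^+ m).
  by rewrite -exprM mulnC eN mulrAC mulfV ?mul1r// expf_eq0 pnatr_eq0 andbF.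
have [Ls [sLs <- cLs]] := exists_balanced_split (exprn_gt0 _ epos) concb.
by apply: (cube_free_mean_le _ cS sLs cLs); apply/andP; split.
Qed.
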